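(* Let $F$ be a cobweb tiling sequence, let $s\in\mathbb{N}$, $k_1,\dots,k_s\in\mathbb{N}$ and $n=k_1+k_2+\dots+k_s$. Then the multi $F$-nomial coefficient $\binom{n}{k_1,k_2,\dots,k_s}_F$ is the number of max-disjoint equipotent copies $\sigma P_{k_1,k_2,\dots,k_s}$ of the layer $\langle\Phi_1\rightarrow\Phi_n\rangle$; that is, whenever the layer $\langle\Phi_1\rightarrow\Phi_n\rangle$ is partitioned into pairwise max-disjoint multi-blocks of the form $\sigma P_{k_1,k_2,\dots,k_s}$, the number of multi-blocks in the partition equals $\binom{n}{k_1,k_2,\dots,k_s}_F$.
   Context: $\mathbb{N}=\{1,2,3,\dots\}$. Let $F=\{n_F\}_{n\ge 0}$ be a sequence of nonnegative integers with $n_F\ge 1$ for $n\ge1$; put $n_F!=n_F(n-1)_F\cdots 1_F$, $0_F!=1$, and $\binom{n}{k_1,\dots,k_s}_F=\frac{n_F!}{(k_1)_F!\cdots(k_s)_F!}$ for $k_1+\dots+k_s=n$. Cobweb poset: the graded poset designated by $F$ has levels $\Phi_1,\Phi_2,\dots$, pairwise disjoint, with $|\Phi_i|=i_F$, and $x<y$ if and only if $x\in\Phi_i$, $y\in\Phi_j$ with $i<j$. The layer $\langle\Phi_a\rightarrow\Phi_b\rangle$ ($a\le b$) is the subposet on $\Phi_a\cup\dots\cup\Phi_b$; its maximal chains are obtained by choosing one vertex from each of the levels $\Phi_a,\dots,\Phi_b$. Blocks: for $m=b-a+1$, a block of the form $\sigma P_m$ in the layer $\langle\Phi_a\rightarrow\Phi_b\rangle$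 is a subposet obtained by choosing a subset of each of the $m$ levels such that the list of the sizes of the chosen subsets, from the lowest to the highest level, is some permutation $\sigma$ of $(1_F,2_F,\dots,m_F)$. Similarly, for $n=k_1+\dots+k_s$, a multi-block of the form $\sigma P_{k_1,\dots,k_s}$ in the layer $\langle\Phi_1\rightarrow\Phi_n\rangle$ is a subposet obtained by choosing a subset of each of the $n$ levels such that the list of sizes is some permutation $\sigma$ of the list of length $n$ $$(1_F,2_F,\dots,(k_1)_F,\;1_F,\dots,(k_2)_F,\;\dots,\;1_F,\dots,(k_s)_F).$$ Different blocks may use different permutations $\sigma$. The maximal chains of a block are those maximal chains of the layer all of whose vertices lie in the block. Two blocks are max-disjoint if they have no maximal chain in common. A layer is partitioned (tiled) by blocks if the blocks are pairwise max-disjoint and every maximal chain of the layer is a maximal chain of one of them. $F$ is a cobweb tiling sequence if for all integers $0\le k<n$ the layer $\langle\Phi_{k+1}\rightarrow\Phi_n\rangle$ can be partitioned into pairwise max-disjoint blocks of the form $\sigma P_{n-k}$. *)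

(* Defs.v *)
From mathcomp Require Import all_boot all_order all_algebra.

Set Implicit Arguments.
Unset Strict Implicit.
Unset Printing Implicit Defensive.

Import GRing.Theory.

(* The vertices of <Phi_a -> Phi_b>, for a <= b: the pair (i, x) is the x-th
   vertex of the level Phi_(a + i), which has F (a + i) elements. *)
Definition layer (F : nat -> nat) (a b : nat) : finType :=
  {i : 'I_(b.+1 - a) & 'I_(F (a + i))}.

Section Layer.
Variables (F : nat -> nat) (a b : nat).
Implicit Types (x y : layer F a b) (B C : {set layer F a b}).

Definition level x : nat := a + tag x.

Definition Phi (i : nat) : {set layer F a b} := [set x | level x == i].

Definition cobweb_lt x y : bool := level x < level y.

Definition chain C : bool :=
  [forall x in C, forall y in C, [|| x == y, cobweb_lt x y | cobweb_lt y x]].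

Definition max_chain C : bool := maxset chain C.

(* Maximality is in the whole layer, not in B. *)
Definition max_chains B : {set {set layer F a b}} :=
  [set C | max_chain C && (C \subset B)].

(* Choosing a subset of every level amounts to choosing a subset B of the
   layer; perm_eq leaves the permutation sigma free for each block. *)
Definition is_block (sizes : seq nat) B : bool :=
  perm_eq [seq #|B :&: Phi i| | i <- iota a (b.+1 - a)] sizes.

Definition max_disjoint B1 B2 : bool :=
  [disjoint max_chains B1 & max_chains B2].

Definition tiled_by (sizes : seq nat) (P : {set {set layer F a b}}) : Prop :=
  [/\ {in P, forall B, is_block sizes B},
      {in P &, forall B1 B2, B1 != B2 -> max_disjoint B1 B2}
    & forall C, max_chain C -> exists2 B, B \in P & C \in max_chains B].

End Layer.

Definition block_sizes (F : nat -> nat) (m : nat) : seq nat :=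
  [seq F j | j <- iota 1 m].

Definition multi_sizes (F : nat -> nat) (s : nat) (k : 'I_s -> nat) : seq nat :=
  flatten [seq block_sizes F (k i) | i <- enum 'I_s].

Definition cobweb_tiling (F : nat -> nat) : Prop :=
  forall k n : nat, k < n ->
    exists P : {set {set layer F k.+1 n}}, tiled_by (block_sizes F (n - k)) P.

Definition Ffact (F : nat -> nat) (n : nat) : nat := \prod_(1 <= i < n.+1) F i.

(* The quotient is taken in rat, so that no divisibility is presupposed. *)
Definition multi_Fnomial (F : nat -> nat) (n s : nat) (k : 'I_s -> nat) : rat :=
  ((Ffact F n)%:R / (\prod_(i < s) Ffact F (k i))%:R)%R.

(* Main.v *)
Require Import Defs.
From mathcomp Require Import all_boot all_order all_algebra.

(** The proof is a double count of the maximal chains of the layer.  When no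
    level of the layer is empty, a maximal chain is exactly a choice of one
    vertex in each level ([max_chainP]), so a subset [B] of the layer carries
    as many maximal chains as the product of the sizes of its traces on the
    levels ([card_max_chains]).  The order of the factors is irrelevant, which
    is why the permutations sigma do not matter: a multi-block carries
    [\prod_i (k_i)_F!] maximal chains, whichever permutation it uses.  The whole
    layer carries [n_F!] of them, and a tiling by blocks of equal product
    distributes these evenly over its blocks ([card_tiling]), so the number
    of blocks is the quotient, the multi F-nomial coefficient. *)

Set Implicit Arguments.
Unset Strict Implicit.
Unset Printing Implicit Defensive.

Section CountingChains.
Variables (F : nat -> nat) (a b : nat).
Hypothesis level_gt0 : forall i : 'I_(b.+1 - a), 0 < F (a + i).
Implicit Types (x y : layer F a b) (B C : {set layer F a b}).

Lemma mem_Phi_tag x (i : 'I_(b.+1 - a)) :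
  (x \in Phi F a b (a + i)) = (tag x == i).
Proof. by rewrite inE /level eqn_add2l. Qed.

Lemma card_Phi (i : 'I_(b.+1 - a)) : #|Phi F a b (a + i)| = F (a + i).
Proof.
pose inj (u : 'I_(F (a + i))) : layer F a b :=
  Tagged (fun j : 'I_(b.+1 - a) => 'I_(F (a + j))) u.
have inj_inj : injective inj by move=> u v /eqP; rewrite eq_Tagged => /eqP.
rewrite -[RHS]card_ord -(card_imset predT inj_inj).
apply: eq_card => x; rewrite mem_Phi_tag.
apply/eqP/imsetP => [|[u _ ->] //].
by case: x => j u /= jE; case: i / jE @inj {inj_inj}; exists u.
Qed.

Lemma chain_tag_inj C : reflect {in C &, injective tag} (chain C).
Proof.
apply: (iffP forall_inP) => [chC x y Cx Cy eq_xy | injC x Cx].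
  have /forall_inP/(_ y Cy) := chC x Cx.
  by rewrite /cobweb_lt /level eq_xy ltnn !orbF => /eqP.
apply/forall_inP => y Cy; rewrite /cobweb_lt /level !ltn_add2l.
by case: (ltngtP (tag x) (tag y)); rewrite ?orbT // => /val_inj/injC ->;
  rewrite ?eqxx.
Qed.

(** A chain that misses a level can be extended by any vertex of that level,
    which is comparable to every vertex of the others; here it matters that
    levels are nonempty. *)
Lemma max_chainP C :
  reflect (chain C /\ forall i, exists2 x, x \in C & tag x = i) (max_chain C).
Proof.
apply: (iffP maxsetP) => [[chC maxC] | [chC meetC]].
  split=> // i; case: (pickP [pred x in C | tag x == i]) => [x|no_x].
    by case/andP=> Cx /eqP; exists x.
  have missC x : x \in C -> tag x <> i.
    by move=> Cx /eqP xi; have := no_x x; rewrite /= Cx xi.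
  pose z : layer F a b :=
    Tagged (fun j : 'I_(b.+1 - a) => 'I_(F (a + j))) (Ordinal (level_gt0 i)).
  have chzC : chain (z |: C).
    apply/chain_tag_inj => x y; rewrite !inE.
    case/predU1P=> [->|Cx]; case/predU1P=> [->|Cy] //=.
    - by move/esym/(missC y Cy).
    - by move/(missC x Cx).
    - by move/chain_tag_inj: chC; apply.
  by exists z => //; rewrite -(maxC _ chzC (subsetUr _ _)) setU11.
split=> // D /chain_tag_inj injD sCD; apply/eqP; rewrite eqEsubset sCD andbT.
apply/subsetP=> y Dy; have [x Cx eq_xy] := meetC (tag y).
by rewrite -(injD x y) // (subsetP sCD).
Qed.

(** Maximal chains inside [B] are the images of the choice functions [f] with
    [f i] in the trace of [B] on level [i]; such an [f] can be read off its
    image because its values lie on distinct levels. *)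
Lemma card_max_chains B :
  #|max_chains B| = \prod_(i < b.+1 - a) #|B :&: Phi F a b (a + i)|.
Proof.
pose trace (i : 'I_(b.+1 - a)) := mem (B :&: Phi F a b (a + i)).
pose graph (f : {ffun 'I_(b.+1 - a) -> layer F a b}) := [set f i | i in predT].
have traceP f : f \in family trace -> forall i, f i \in B /\ tag (f i) = i.
  by move/familyP => Bf i; move: (Bf i); rewrite /trace inE mem_Phi_tag
    => /andP[-> /eqP].
have graph_inj : {in family trace &, injective graph}.
  move=> f g /traceP fP /traceP gP eq_fg; apply/ffunP => i.
  have : f i \in graph g by rewrite -eq_fg imset_f.
  by case/imsetP=> j _ fij; rewrite fij -(gP j).2 -fij (fP i).2.
have -> : max_chains B = graph @: family trace.
  apply/setP=> C; rewrite inE; apply/andP/imsetP => [[maxC sCB]|[f fB ->]].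
    have [/chain_tag_inj injC meetC] := max_chainP C maxC.
    have ptP i : exists x, (x \in C) && (tag x == i).
      by have [x Cx xi] := meetC i; exists x; rewrite Cx xi eqxx.
    pose f := [ffun i => xchoose (ptP i)].
    have fP i : f i \in C /\ tag (f i) = i.
      by rewrite ffunE; have /andP[-> /eqP] := xchooseP (ptP i).
    exists f.
      apply/familyP => i; have [Cfi fi] := fP i.
      by rewrite /trace inE mem_Phi_tag fi eqxx (subsetP sCB).
    apply/setP=> x; apply/idP/imsetP => [Cx | [i _ ->]]; last by case: (fP i).
    by exists (tag x) => //; have [Cfx fx] := fP (tag x); apply: injC.
  have {fB} fP := traceP f fB; split.
    apply/max_chainP; split.
      apply/chain_tag_inj => _ _ /imsetP[i _ ->] /imsetP[j _ ->].
      by rewrite (fP i).2 (fP j).2 => ->.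
    by move=> i; exists (f i); [apply: imset_f | case: (fP i)].
  by apply/subsetP => _ /imsetP[i _ ->]; case: (fP i).
rewrite card_in_imset // card_family foldrE big_map big_enum.
by apply: eq_bigr => i _; apply: eq_card.
Qed.

Lemma card_max_chains_layer :
  #|max_chains [set: layer F a b]| = \prod_(i < b.+1 - a) F (a + i).
Proof.
by rewrite card_max_chains; apply: eq_bigr => i _; rewrite setTI card_Phi.
Qed.

Lemma card_max_chains_block sizes B :
  is_block sizes B -> #|max_chains B| = \prod_(c <- sizes) c.
Proof.
move=> permB; rewrite card_max_chains -(perm_big _ permB) /= big_map.
rewrite -(big_mkord predT (fun i => #|B :&: Phi F a b (a + i)|)).
by rewrite -[in iota _ _](addn0 a) iotaDl big_map /index_iota subn0 addn0.
Qed.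

Lemma card_tiling sizes (P : {set {set layer F a b}}) :
  tiled_by sizes P ->
  #|P| * \prod_(c <- sizes) c = \prod_(i < b.+1 - a) F (a + i).
Proof.
case=> blockP disjP coverP; rewrite -card_max_chains_layer.
have -> : max_chains [set: layer F a b] = \bigcup_(B in P) max_chains B.
  apply/setP=> C; rewrite inE subsetT andbT.
  apply/idP/bigcupP => [/coverP[B] | [B _]]; first by exists B.
  by rewrite inE => /andP[].
rewrite [\bigcup_(B in P) _]big_mkcond -[RHS]sum1_card.
rewrite partition_disjoint_bigcup => [|B1 B2 neqB].
  rewrite -sum_nat_const big_mkcond; apply: eq_bigr => B _.
  case: ifP => [PB | _]; last by rewrite big_set0.
  by rewrite sum1_card (card_max_chains_block (blockP B PB)).
case: ifP => [PB1 | _]; last by rewrite -setI_eq0 set0I.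
by case: ifP => [PB2 | _]; [apply: disjP | rewrite -setI_eq0 setI0].
Qed.

End CountingChains.

Lemma prod_block_sizes F m : \prod_(c <- block_sizes F m) c = Ffact F m.
Proof. by rewrite /block_sizes big_map /Ffact /index_iota subn1. Qed.

Lemma prod_multi_sizes F s (k : 'I_s -> nat) :
  \prod_(c <- multi_sizes F k) c = \prod_(i < s) Ffact F (k i).
Proof.
rewrite /multi_sizes big_flatten big_map big_enum /=.
by apply: eq_bigr => i _; rewrite prod_block_sizes.
Qed.

Lemma Ffact_gt0 F m : (forall n, 0 < n -> 0 < F n) -> 0 < Ffact F m.
Proof.
move=> F_gt0; rewrite /Ffact big_nat.
by apply: prodn_cond_gt0 => i /andP[/F_gt0].
Qed.

Theorem mainTheorem2 (F : nat -> nat)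
    (F_gt0 : forall n : nat, 0 < n -> 0 < F n)
    (F_tiling : cobweb_tiling F)
    (s : nat) (s_gt0 : 0 < s)
    (k : 'I_s -> nat) (k_gt0 : forall i : 'I_s, 0 < k i)
    (n : nat) (n_eq : n = \sum_(i < s) k i)
    (P : {set {set layer F 1 n}})
    (P_tiles : tiled_by (multi_sizes F k) P) :
  (#|P|%:R)%R = multi_Fnomial F n k.
Proof.
have level_gt0 (i : 'I_(n.+1 - 1)) : 0 < F (1 + i) by apply: F_gt0.
have := card_tiling level_gt0 P_tiles; rewrite prod_multi_sizes => count.
have nE : Ffact F n = \prod_(i < n.+1 - 1) F (1 + i).
  by rewrite /Ffact big_add1 -(big_mkord predT (fun i => F (1 + i))) subn1.
have blocks_neq0 : ((\prod_(i < s) Ffact F (k i))%:R != 0 :> rat)%R.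
  rewrite Num.Theory.pnatr_eq0 -lt0n.
  by apply: prodn_gt0 => i; apply: Ffact_gt0.
by rewrite /multi_Fnomial nE -count GRing.natrM GRing.mulfK.
Qed.
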